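(* Let $\mathcal{H}$ be a separable Hilbert space and let $\mathcal{C}$ be a nonempty set of closed subspaces of $\mathcal{H}$, identified with the set of orthogonal projectors $\{Q_V:V\in\mathcal{C}\}\subset\mathcal{B}(\mathcal{H})$. Then $\mathcal{C}$ has MSAP if and only if $$\mathcal{T}(\mathcal{C}^+)=\mathcal{T}\big(\overline{\mathcal{C}^+}\big),$$ where $\mathcal{T}(E)$ denotes the set of contact half-spaces of $E$ in $\mathcal{B}(\mathcal{H})$ equipped with the weak operator topology.
   Context: $\mathcal{B}(\mathcal{H})$ is the algebra of bounded linear operators on $\mathcal{H}$. A set $\mathcal{C}$ of closed subspaces of $\mathcal{H}$ has the Minimum Subspace Approximation Property (MSAP) if for every finite subset $F\subset\mathcal{H}$ there exists an element of $\mathcal{C}$ that minimizes $e(F,V)=\sum_{f\in F}d^2(f,V)$ over all $V\in\mathcal{C}$, where $d(f,V)$ is the distance from $f$ to $V$. A closed subspace $V$ is identified with the orthogonal projector $Q_V=I-P_V$, where $P_V$ is the orthogonal projector onto $V$ (so $\ker Q_V=V$); the set of projectors $\{Q_V:V\in\mathcal{C}\}$ is again denoted $\mathcal{C}$. $\mathcal{P}^+(\mathcal{H})$ is the set of non-negative self-adjoint operators in $\mathcal{B}(\mathcal{H})$, and $\mathcal{C}^+=\mathcal{C}+\mathcal{P}^+(\mathcal{H})=\{Q+N:Q\in\mathcal{C},\ N\in\mathcal{P}^+(\mathcal{H})\}$. Closures are in the weak operator topology. Let $X$ be a locally convex topological vector space (here $X=\mathcal{B}(\mathcal{H})$ with the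 weak operator topology). A (closed) half-space is a set $H_{\phi,a}=\{x\in X:\phi(x)\ge a\}$ with $a\in\mathbb{R}$ and $\phi:X\to\mathbb{R}$ a continuous $\mathbb{R}$-linear functional; its boundary is the affine hyperplane $\{x:\phi(x)=a\}$. A contact half-space of a subset $E\subset X$ is a half-space that contains $E$ and whose boundary intersects $E$ non-trivially (i.e. in a nonempty set). $\mathcal{T}(E)$ denotes the set of all contact half-spaces of $E$. *)

(* Defs.v *)
From HB Require Import structures.
From mathcomp Require Import all_boot all_order all_algebra sesquilinear.
From mathcomp Require Import finmap complex.
From mathcomp Require Import boolp classical_sets functions cardinality.
From mathcomp Require Import reals topology normedtype.

Set Implicit Arguments.
Unset Strict Implicit.
Unset Printing Implicit Defensive.

Import Order.TTheory GRing.Theory Num.Theory.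
Import numFieldNormedType.Exports.

Local Open Scope classical_set_scope.
Local Open Scope ring_scope.

(* The scalar field of a Hilbert space is R or R[i]; the two cases are treated
   uniformly. *)
Variant scalar_kind := RealScalars | ComplexScalars.

Definition scalars (R : realType) (k : scalar_kind) : numFieldType :=
  match k with RealScalars => R | ComplexScalars => R[i] end.

Definition sconj (R : realType) (k : scalar_kind) :
    {rmorphism scalars R k -> scalars R k} :=
  match k return {rmorphism scalars R k -> scalars R k} with
  | RealScalars => idfun : {rmorphism R -> R}
  | ComplexScalars => Num.conj : {rmorphism R[i] -> R[i]}
  end.

Definition sre (R : realType) (k : scalar_kind) : scalars R k -> R :=
  match k return scalars R k -> R with
  | RealScalars => id
  | ComplexScalars => @complex.Re R
  end.

Definition sofreal (R : realType) (k : scalar_kind) :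
    {rmorphism R -> scalars R k} :=
  match k return {rmorphism R -> scalars R k} with
  | RealScalars => idfun : {rmorphism R -> R}
  | ComplexScalars => real_complex R : {rmorphism R -> R[i]}
  end.

(* The inner product is linear in its first argument. *)
HB.mixin Record isInnerProductSpace (R : realType) (k : scalar_kind) H
    & NormedModule (scalars R k) H := {
  inner : {dot H for @sconj R k} ;
  sqr_norm_inner : forall x : H, `|x| ^+ 2 = inner x x }.

#[short(type="hilbertType")]
HB.structure Definition Hilbert (R : realType) (k : scalar_kind) :=
  {H of CompleteNormedModule (scalars R k) H & isInnerProductSpace R k H}.

Definition separable (T : topologicalType) :=
  exists2 S : set T, countable S & dense S.

Section BoundedOperators.
Variables (R : realType) (k : scalar_kind) (H : hilbertType R k).

Definition bounded_operator : {pred H -> H} :=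
  [pred T | `[< linear T /\ exists M, forall x, `|T x| <= M * `|x| >]].

Lemma bounded_operator_submod : submod_closed bounded_operator.
Proof.
split; rewrite ?inE.
  split; first by move=> a x y; rewrite /= scaler0 addr0.
  by exists 0 => x; rewrite /= normr0 mul0r.
move=> a f g; rewrite !inE => -[fL [M fM]] [gL [N gN]]; split.
  move=> b x y.
  rewrite -![(a *: f + g) _]/(a *: f _ + g _) fL gL !scalerDr !scalerA mulrC.
  by rewrite !addrA; congr (_ + _); rewrite -!addrA [a *: f y + _]addrC !addrA.
exists (`|a| * M + N) => x; rewrite mulrDl -mulrA.
apply: le_trans (ler_normD _ _) (lerD _ (gN x)).
by rewrite normrZ ler_wpM2l.
Qed.

HB.instance Definition _ :=
  GRing.isSubmodClosed.Build _ _ bounded_operator bounded_operator_submod.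

End BoundedOperators.

Record bop (R : realType) (k : scalar_kind) (H : hilbertType R k) := Bop {
  bop_fun :> H -> H ;
  _ : bop_fun \in @bounded_operator R k H }.
HB.instance Definition _ R k H := [isSub for @bop_fun R k H].
HB.instance Definition _ R k H := [Choice of @bop R k H by <:].
HB.instance Definition _ R k (H : hilbertType R k) :=
  [SubChoice_isSubZmodule of bop H by <:].

Section RealScaling.
Variables (R : realType) (k : scalar_kind) (H : hilbertType R k).

Lemma bop_scale_subproof (r : R) (T : bop H) :
  sofreal R k r *: (T : H -> H) \in @bounded_operator R k H.
Proof. by apply: rpredZ; apply: valP. Qed.

Definition bop_scale (r : R) (T : bop H) : bop H :=
  Bop (bop_scale_subproof r T).

Lemma bop_scaleA a b T : bop_scale a (bop_scale b T) = bop_scale (a * b) T.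
Proof. by apply: val_inj; rewrite /= scalerA rmorphM. Qed.

Lemma bop_scale1 : left_id 1 bop_scale.
Proof. by move=> T; apply: val_inj; rewrite /= rmorph1 scale1r. Qed.

Lemma bop_scaleDr : right_distributive bop_scale +%R.
Proof. by move=> a T U; apply: val_inj; rewrite /= scalerDr. Qed.

Lemma bop_scaleDl T : {morph bop_scale^~ T : a b / a + b}.
Proof. by move=> a b; apply: val_inj; rewrite /= rmorphD scalerDl. Qed.

(* [bop H] is B(H) as a vector space over the reals, also when the scalars of H are
   complex: half-spaces are defined by R-linear functionals. *)
HB.instance Definition _ := GRing.Zmodule_isLmodule.Build R (bop H)
  bop_scaleA bop_scale1 bop_scaleDr bop_scaleDl.

End RealScaling.

(* The weak operator topology on B(H): the coarsest topology making all the
   maps T |-> <T x, y> continuous. *)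
Definition matrix_coefs (R : realType) (k : scalar_kind) (H : hilbertType R k)
    (T : bop H) : prod_topology (fun _ : H * H => scalars R k) :=
  fun xy => inner (T xy.1) xy.2.

HB.instance Definition _ (R : realType) (k : scalar_kind)
    (H : hilbertType R k) :=
  Topological.copy (bop H) (initial_topology (@matrix_coefs R k H)).

Section HalfSpaces.
Variables (R : realType) (X : preTopologicalLmodType R).

Definition half_space (phi : {linear X -> R^o}) (a : R) : set X :=
  [set x | a <= phi x].

Definition hyperplane (phi : {linear X -> R^o}) (a : R) : set X :=
  [set x | phi x = a].

Definition contact_half_spaces (E : set X) : set (set X) :=
  [set S | exists (phi : {linear X -> R^o}) (a : R),
    [/\ continuous phi, S = half_space phi a, E `<=` S &
        E `&` hyperplane phi a !=set0]].

End HalfSpaces.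

Section Subspaces.
Variables (R : realType) (k : scalar_kind) (H : hilbertType R k).

Definition closed_subspace (V : set H) :=
  closed V /\ submod_closed [pred x in V].

Definition dist (f : H) (V : set H) : R := inf [set sre `|f - v| | v in V].

Definition approx_error (F : {fset H}) (V : set H) : R :=
  \sum_(f <- F) dist f V ^+ 2.

Definition MSAP (C : set (set H)) :=
  forall F : {fset H}, exists2 V, C V &
    forall W, C W -> approx_error F V <= approx_error F W.

Definition orthogonal_projector (V : set H) (P : bop H) :=
  forall x, V (P x) /\ forall v, V v -> inner (x - P x) v = 0.

(* The set of the operators Q_V = I - P_V for V in C. *)
Definition projectors (C : set (set H)) : set (bop H) :=
  [set Q | exists V P, [/\ C V, orthogonal_projector V P &
                           forall x, Q x = x - P x]].

Definition self_adjoint (T : bop H) :=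
  forall x y, inner (T x) y = inner x (T y).

Definition nonneg_operators : set (bop H) :=
  [set N | self_adjoint N /\ forall x, 0 <= inner (N x) x].

Definition Cplus (C : set (set H)) : set (bop H) :=
  [set Q + N | Q in projectors C & N in nonneg_operators].

End Subspaces.

(* Main.v *)
Require Import Defs.
From HB Require Import structures.
From mathcomp Require Import all_boot all_order all_algebra sesquilinear.
From mathcomp Require Import finmap complex.
From mathcomp Require Import boolp classical_sets functions.
From mathcomp Require Import reals topology normedtype.
From mathcomp Require Import ring lra.

(** For a closed subspace V the error e(F, V) is the value at Q_V of the weakly
    continuous functional T |-> sum over f in F of <T f, f>, which is nonnegative on
    nonnegative operators. So minimizing e(F, V) over C is minimizing this functional
    over Cplus C, and the minimum is attained exactly when the half-space where the
    functional is at least the infimum touches Cplus C. The theorem follows from two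
    facts.

    The first is that, conversely, every half-space that contains Cplus C is defined by
    such a functional, as far as self-adjoint operators are concerned
    ([positive_functional]). A weakly continuous functional is a finite real combination
    of coefficients <T x, y>, hence, on self-adjoint operators, of quadratic forms <T x,
    x>; and since Cplus C absorbs nonnegative operators, it is nonnegative on them. A
    real combination of squares <T x, x> that is nonnegative on them is a sum of such
    squares: the negative ones are absorbed one at a time by rotations
    ([absorb_square]). The vectors obtained are linearly independent, hence distinct, so
    that they form a finite set F. If C has MSAP, the functional thus has a minimum on
    Cplus C, which is also its minimum on the closure; a half-space touching the closure
    touches Cplus C ([MSAP_contact]).

    The second is that the infimum of e(F, V) is always attained on the closure. The
    unit ball is weakly compact ([contraction_ultra_cvg]), so a minimizing family of
    projectors has a weak limit point, at which the half-space of the functional touches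
    the closure of Cplus C. If this half-space also touches Cplus C, at Q_V + N, then V
    minimizes e(F, V) ([contact_MSAP]).

    Real and complex Hilbert spaces are treated together through the real inner product
    Re <x, y>, whose values at all scalar multiples of x determine <x, y>. *)

Set Implicit Arguments.
Unset Strict Implicit.
Unset Printing Implicit Defensive.

Import Order.TTheory GRing.Theory Num.Theory.
Import numFieldNormedType.Exports.

Local Open Scope classical_set_scope.
Local Open Scope ring_scope.

(** * Real and complex scalars *)

Section Scalars.
Variables (R : realType) (k : scalar_kind).
Implicit Types (z w : scalars R k) (r : R).
Local Notation "r %:S" := (sofreal R k r) (at level 2, format "r %:S").

Lemma sreD : {morph @sre R k : z w / z + w}.
Proof. by case: k => [//|[a b] [c d]]. Qed.

Lemma sre_sofreal r : sre r%:S = r.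
Proof. by case: k. Qed.

Lemma sreZ r z : sre (r%:S * z) = r * sre z.
Proof. by case: k z => [//|[a b]] /=; rewrite mul0r subr0. Qed.

Lemma sre_conj z : sre (sconj R k z) = sre z.
Proof. by case: k z => [//|[a b]]. Qed.

Lemma sconj_sofreal r : sconj R k r%:S = r%:S.
Proof. by case: k => //=; exact: conjc_real. Qed.

Lemma sconjK : involutive (sconj R k).
Proof. by case: k => [//|z]; exact: conjCK. Qed.

Lemma mul_sconj z : z * sconj R k z = `|z| ^+ 2.
Proof.
by case: k z => z; apply: esym; [exact: (@real_normK R) (num_real z)|exact: normCK].
Qed.

Lemma sofreal_le r s : (r%:S <= s%:S) = (r <= s).
Proof. by case: k => //=; exact: lecR. Qed.

Lemma sofreal_lt r s : (r%:S < s%:S) = (r < s).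
Proof. by case: k => //=; exact: ltcR. Qed.

Lemma ge0_sofreal z : 0 <= z -> (sre z)%:S = z.
Proof. by case: k z => //= -[a b]; rewrite lecE /= => /andP[/eqP-> _]. Qed.

Lemma norm_sofreal z : (sre `|z|)%:S = `|z|.
Proof. exact: ge0_sofreal. Qed.

Lemma sofreal_norm r : `|r%:S| = `|r|%:S.
Proof. by case: k => //=; rewrite normc_def /= expr0n addr0 sqrtr_sqr. Qed.

Lemma le_sre_norm z : `|sre z| <= sre `|z|.
Proof.
rewrite -sofreal_le norm_sofreal.
by case: k z => [z//|z] /=; exact: normc_ge_Re.
Qed.

(** The multiplier u recovers the imaginary part of z as a real part: it is -i for complex
    scalars, and 0 for real ones. This lets real parts of matrix coefficients replace the
    coefficients themselves. *)
Lemma norm_le_sre : exists u : scalars R k, forall z,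
  sre `|z| <= `|sre z| + `|sre (u * z)|.
Proof.
case: k => /=; first by exists 0 => z; rewrite lerDl.
exists (- 'i%C)%R => -[a b] /=.
rewrite oppr0 mul0r mulN1r opprK add0r -[leRHS]ger0_norm ?addr_ge0//.
rewrite -sqrtr_sqr ler_wsqrtr// sqrrD !real_normK ?num_real//.
by rewrite -addrA [X in _ <= _ + X]addrC lerD2l lerDl mulrn_wge0// mulr_ge0.
Qed.

Lemma sre0 : sre (0 : scalars R k) = 0.
Proof. by case: k. Qed.

Lemma sreN z : sre (- z) = - sre z.
Proof. by case: k z => [//|[]]. Qed.

Lemma sre_ge0 z : 0 <= z -> 0 <= sre z.
Proof. by move=> z0; rewrite -sofreal_le ge0_sofreal// rmorph0. Qed.

Lemma sre_ext z w : (forall a, sre (a * z) = sre (a * w)) -> z = w.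
Proof.
move=> zw; apply/eqP; rewrite -subr_eq0 -normr_eq0 -norm_sofreal.
have [u le_u] := norm_le_sre.
suff -> : sre `|z - w| = 0 by rewrite rmorph0.
apply/eqP; rewrite eq_le sre_ge0// andbT.
apply: le_trans (le_u _) _; have := zw 1; rewrite !mul1r => zw1.
by rewrite mulrBr !sreD !sreN zw zw1 !subrr normr0 addr0.
Qed.

Lemma sre_continuous : continuous (@sre R k).
Proof.
move=> z; apply/(@cvgrPdist_lt R R (scalars R k) _ (nbhs_filter z)) => e e0.
have e1 : 0 < e%:S by rewrite -[0](rmorph0 (sofreal R k)) sofreal_lt.
near=> w; have : ball z e%:S w by near: w; exact: nbhsx_ballx.
rewrite -ball_normE /= => zw.
rewrite -sreN -sreD; apply: le_lt_trans (le_sre_norm _) _.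
by rewrite -sofreal_lt norm_sofreal.
Unshelve. all: by end_near. Qed.

(** Multiplying a vector g by a unimodular u changes no value <Tg, g>, so this makes an
    inner product <g, e> real and nonnegative at no cost. *)
Lemma phase z : exists2 u : scalars R k, u * sconj R k u = 1 & u * z = `|z|.
Proof.
have [->|z0] := eqVneq z 0.
  by exists 1; rewrite ?rmorph1 ?mulr1// normr0 mul1r.
exists (`|z| / z); last by rewrite divfK.
by rewrite mul_sconj normf_div normr_id divff ?normr_eq0// expr1n.
Qed.

End Scalars.

(** * The underlying real inner product *)

Section RealInner.
Variables (R : realType) (k : scalar_kind) (H : hilbertType R k).
Implicit Types (x y v : H) (r : R) (a : scalars R k).
Local Notation "r %:S" := (sofreal R k r) (at level 2, format "r %:S").

Lemma innerC x y : inner x y = sconj R k (inner y x).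
Proof. by rewrite (hermC (@inner R k H)) expr0 mul1r. Qed.

Lemma innerDl x y v : inner (x + y) v = inner x v + inner y v.
Proof. exact: linearDl. Qed.

Lemma innerZl a x y : inner (a *: x) y = a * inner x y.
Proof. exact: linearZl_LR. Qed.

Lemma innerZr a x y : inner x (a *: y) = sconj R k a * inner x y.
Proof. by rewrite innerC innerZl rmorphM -innerC. Qed.

Lemma innerDr x y v : inner v (x + y) = inner v x + inner v y.
Proof. by rewrite innerC innerDl rmorphD -!innerC. Qed.

Definition rip x y : R := sre (inner x y).

Lemma ripC x y : rip x y = rip y x.
Proof. by rewrite /rip innerC sre_conj. Qed.

Lemma ripDl x y v : rip (x + y) v = rip x v + rip y v.
Proof. by rewrite /rip innerDl sreD. Qed.

Lemma ripDr x y v : rip v (x + y) = rip v x + rip v y.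
Proof. by rewrite !(ripC v) ripDl. Qed.

Lemma ripZl r x y : rip (r%:S *: x) y = r * rip x y.
Proof. by rewrite /rip innerZl sreZ. Qed.

Lemma ripZr r x y : rip x (r%:S *: y) = r * rip x y.
Proof. by rewrite ripC ripZl ripC. Qed.

Lemma ripZC a x y : rip (a *: x) y = rip x (sconj R k a *: y).
Proof. by rewrite /rip innerZl innerZr sconjK. Qed.

Lemma ripNl x y : rip (- x) y = - rip x y.
Proof. by rewrite -scaleN1r -(rmorphN1 (sofreal R k)) ripZl mulN1r. Qed.

Lemma ripNr x y : rip x (- y) = - rip x y.
Proof. by rewrite ripC ripNl ripC. Qed.

Lemma ripBl x y v : rip (x - y) v = rip x v - rip y v.
Proof. by rewrite ripDl ripNl. Qed.

Lemma ripBr x y v : rip v (x - y) = rip v x - rip v y.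
Proof. by rewrite ripDr ripNr. Qed.

Lemma rip0l x : rip 0 x = 0.
Proof. by rewrite -(subrr 0) ripBl subrr. Qed.

Lemma rip0r x : rip x 0 = 0.
Proof. by rewrite ripC rip0l. Qed.

Definition ripE := (ripDl, ripDr, ripNl, ripNr, ripZl, ripZr, rip0l, rip0r).

Lemma inner_rip x : inner x x = (rip x x)%:S.
Proof. by rewrite /rip -sqr_norm_inner ge0_sofreal// exprn_ge0. Qed.

Definition rnorm x : R := sre `|x|.

Lemma norm_rnorm x : `|x| = (rnorm x)%:S.
Proof. by rewrite /rnorm ge0_sofreal. Qed.

Lemma rnorm_ge0 x : 0 <= rnorm x.
Proof. exact: sre_ge0. Qed.

Lemma rip_rnorm x : rip x x = rnorm x ^+ 2.
Proof. by rewrite /rip -sqr_norm_inner norm_rnorm -rmorphXn sre_sofreal. Qed.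

Lemma rip_ge0 x : 0 <= rip x x.
Proof. by rewrite rip_rnorm exprn_ge0// rnorm_ge0. Qed.

Lemma rip_eq0 x : rip x x = 0 -> x = 0.
Proof.
rewrite rip_rnorm => /eqP; rewrite sqrf_eq0 => /eqP x0.
by apply/eqP; rewrite -normr_eq0 norm_rnorm x0 rmorph0.
Qed.

Lemma rip_ext x y : (forall v, rip x v = rip y v) -> x = y.
Proof.
move=> xy; apply/eqP; rewrite -subr_eq0; apply/eqP/rip_eq0.
by rewrite ripBl xy subrr.
Qed.

(** The squared norm of the component of y orthogonal to x is nonnegative. *)
Lemma cauchy_schwarz x y : `|rip x y| <= rnorm x * rnorm y.
Proof.
rewrite -ler_sqr ?nnegrE ?mulr_ge0 ?rnorm_ge0// real_normK ?num_real//.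
rewrite exprMn -!rip_rnorm.
have [->|x0] := eqVneq x 0; first by rewrite !rip0l mul0r expr0n.
have xx : 0 < rip x x.
  by rewrite lt_neqAle rip_ge0 andbT eq_sym; apply: contra_neq x0; exact: rip_eq0.
have := rip_ge0 (y - (rip x y / rip x x)%:S *: x).
rewrite !ripE (ripC y x) => h; rewrite -subr_ge0.
suff -> : rip x x * rip y y - rip x y ^+ 2 =
  rip x x * (rip y y + - (rip x y / rip x x * rip x y) +
    (- (rip x y / rip x x * rip x y) -
     - (rip x y / rip x x * (rip x y / rip x x * rip x x)))).
  by rewrite mulr_ge0 ?rip_ge0//; lra.
by field; rewrite gt_eqF.
Qed.

Lemma rnorm_continuous : continuous rnorm.
Proof.
move=> x; apply: (continuous_comp (@norm_continuous _ H x)).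
exact: sre_continuous.
Qed.

End RealInner.

(** * Projections and Riesz representation *)

Section Projections.
Variables (R : realType) (k : scalar_kind) (H : hilbertType R k).
Implicit Types (x y v : H) (r : R) (a : scalars R k).
Local Notation "r %:S" := (sofreal R k r) (at level 2, format "r %:S").

(** The first-order condition that makes x - p orthogonal to V at a nearest point p. *)
Lemma linear_le_quadratic (b c : R) : 0 <= c ->
  (forall t : R, 0 <= t ^+ 2 * c - t * b) -> b = 0.
Proof.
move=> c0 /(_ (b / (c + 1))) h; apply/eqP; rewrite -sqrf_eq0 eq_le sqr_ge0 andbT.
have c1 : 0 < c + 1 by rewrite ltr_wpDl.
have : (b / (c + 1)) ^+ 2 * c - b / (c + 1) * b = - (b ^+ 2 / (c + 1) ^+ 2).
  by field; rewrite gt_eqF.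
move=> e; move: h; rewrite e oppr_ge0 pmulr_lle0// invr_gt0 exprn_gt0//.
Qed.

(** Only real subspaces: the projection theorem is applied both to the given closed
    subspaces and to kernels of real-linear functionals. *)
Record real_subspace (V : set H) := RealSubspace {
  real_subspace_closed : closed V;
  real_subspace0 : V 0;
  real_subspaceD : forall x y, V x -> V y -> V (x + y);
  real_subspaceZ : forall r x, V x -> V (r%:S *: x) }.

Lemma ball_rnorm x y r : ball x r%:S y = (rnorm (x - y) < r) :> Prop.
Proof. by rewrite -ball_normE /= norm_rnorm sofreal_lt. Qed.

Lemma ball_sofreal (e : scalars R k) : 0 < e -> exists2 r : R, 0 < r & e = r%:S.
Proof.
move=> e0; exists (sre e); last by rewrite ge0_sofreal// ltW.
by rewrite -(@sofreal_lt R k) ge0_sofreal ?ltW// rmorph0.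
Qed.

(** A minimizing filter of V is Cauchy by the parallelogram law, hence converges to a
    point p of V at minimal distance of x. *)
Lemma nearest_point V x : real_subspace V ->
  exists2 p, V p & forall v, V v -> rip (x - p) (x - p) <= rip (x - v) (x - v).
Proof.
case=> Vc V0 VD VZ; pose q v := rip (x - v) (x - v).
have infV : has_inf (q @` V).
  by split; [exists (q 0), 0|exists 0 => _ [v _ <-]; exact: rip_ge0].
pose d := inf (q @` V).
have dq v : V v -> d <= q v by move=> Vv; apply: ge_inf; [case: infV|exists v].
pose A (e : R) := [set v | V v /\ q v < d + e].
pose F := filter_from [set e : R | 0 < e] A.
have FF : ProperFilter F.
  apply: filter_from_proper; last first.
    move=> e /= e0; have [_ [v Vv <-] qv] := inf_adherent e0 infV.
    by exists v; split.
  apply: filter_from_filter; first by exists 1; rewrite /= ltr01.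
  move=> e e' /= e0 e'0; exists (Num.min e e'); first by rewrite /= lt_min e0.
  move=> v [Vv]; rewrite -ltrBlDl lt_min !ltrBlDl => /andP[? ?].
  by split; split.
have close e u v : A e u -> A e v -> rip (u - v) (u - v) <= 4 * e.
  move=> [Vu qu] [Vv qv].
  have := dq _ (VZ 2^-1 _ (VD _ _ Vu Vv)).
  move: qu qv; rewrite /q !ripE (ripC u x) (ripC v x) (ripC v u).
  by move: (rip x x) (rip x u) (rip x v) (rip u v) (rip u u) (rip v v) => *; lra.
have : cauchy F.
  apply/cauchy_exP => _ /ball_sofreal[r r0 ->].
  have e0 : 0 < r ^+ 2 / 8 by rewrite divr_gt0// exprn_gt0.
  have [_ [v Vv <-] qv] := inf_adherent e0 infV.
  exists v, (r ^+ 2 / 8) => // w Aw; rewrite ball_rnorm.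
  have /close/(_ Aw) := conj Vv qv : A _ v.
  rewrite rip_rnorm => h.
  rewrite -ltr_sqr ?nnegrE ?rnorm_ge0// ?ltW//; apply: le_lt_trans h _.
  have : 0 < r ^+ 2 by rewrite exprn_gt0.
  lra.
move=> /cauchy_cvg Fp; pose p := lim F; exists p.
  apply: Vc => B /Fp [e e0 AB].
  have [_ [v Vv <-] qv] := inf_adherent e0 infV.
  by exists v; split => //; apply: AB.
move=> v Vv; apply: le_trans (dq _ Vv); rewrite -/(q p).
have qc : {for p, continuous q}.
  have -> : q = (fun v0 => rnorm (x - v0) ^+ 2).
    by apply/funext => w; rewrite /q rip_rnorm.
  have c1 : {for p, continuous (fun v0 => x - v0)}.
    by apply: cvgB; [exact: cvg_cst|exact: cvg_id].
  have c2 := continuous_comp c1 (@rnorm_continuous _ _ H _).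
  by apply: cvgM; exact: c2.
apply/ler_addgt0Pr => e e0.
have qF : q @ F --> q p by move=> B /qc /Fp.
apply: (@closed_cvg _ _ F _ q [set r | r <= d + e]) qF.
  exact: closed_le.
by exists e => // w [_ /ltW].
Qed.

Lemma real_projection V x : real_subspace V ->
  exists2 p, V p & forall v, V v -> rip (x - p) v = 0.
Proof.
move=> VS; have [p Vp pmin] := nearest_point x VS; exists p => // v Vv.
have [_ _ VD VZ] := VS.
suff : 2 * rip (x - p) v = 0 by move=> /eqP; rewrite mulf_eq0 pnatr_eq0 => /eqP.
apply: (linear_le_quadratic (rip_ge0 v)) => t.
have := pmin _ (VD _ _ Vp (VZ t _ Vv)).
rewrite opprD addrA [rip (x - p - _) _]ripBl !(ripBr _ (t%:S *: v)) !ripZl !ripZr.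
rewrite (ripC v (x - p)).
by move: (rip (x - p) (x - p)) (rip (x - p) v) (rip v v) => *; lra.
Qed.

(** If l is nonzero, the orthogonal of its kernel is a line, and a suitable multiple of
    any nonzero w on it represents l. *)
Lemma riesz (l : H -> R) (M : R) :
  {morph l : x y / x + y} -> (forall r x, l (r%:S *: x) = r * l x) ->
  (forall x, `|l x| <= M * rnorm x) -> exists z, forall x, l x = rip x z.
Proof.
move=> lD lZ lM.
have lN x : l (- x) = - l x.
  by rewrite -scaleN1r -(rmorphN1 (sofreal R k)) lZ mulN1r.
have kerS : real_subspace [set x | l x = 0].
  split=> /=; last 3 first.
  - by rewrite -(scale0r 0) -(rmorph0 (sofreal R k)) lZ mul0r.
  - by move=> x y lx ly; rewrite lD lx ly addr0.
  - by move=> r x lx; rewrite lZ lx mulr0.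
  move=> p clp /=; apply/eqP; rewrite -normr_le0; apply/ler_addgt0Pr => e e0; rewrite add0r.
  have M0 : 0 < `|M| + 1 by rewrite ltr_wpDl.
  have e1 : 0 < (e / (`|M| + 1))%:S.
    by rewrite -[0](rmorph0 (sofreal R k)) sofreal_lt divr_gt0.
  have [v [/= lv]] := clp _ (nbhsx_ballx p _ e1).
  rewrite ball_rnorm ltr_pdivlMr// => pv.
  have -> : l p = l (p - v) by rewrite lD lN lv subr0.
  apply: le_trans (lM _) _; apply: le_trans (ltW pv); rewrite mulrC.
  rewrite ler_wpM2l ?rnorm_ge0//; apply: le_trans (ler_norm _) _.
  by rewrite lerDl.
have [[x0 lx0]|l0] := pselect (exists x, l x != 0); last first.
  exists 0 => x; rewrite rip0r; apply/eqP/negPn/negP => lx; apply: l0.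
  by exists x.
have [p lp pO] := real_projection x0 kerS.
pose w := x0 - p.
have lw : l w = l x0 by rewrite lD lN lp subr0.
have w0 : rip w w != 0.
  apply: contra_neq lx0 => /rip_eq0 w0; rewrite -lw w0.
  by rewrite -(scale0r 0) -(rmorph0 (sofreal R k)) lZ mul0r.
have lw0 : l w != 0 by rewrite lw.
exists ((l w / rip w w)%:S *: w) => x; rewrite ripZr.
have /pO : [set x | l x = 0] (x - (l x / l w)%:S *: w).
  by rewrite /= lD lN lZ divfK ?subrr.
rewrite -/w ripBr ripZr (ripC w x) => /eqP; rewrite subr_eq0 => /eqP ->.
by field; rewrite w0 lw0.
Qed.

Lemma bop_exists (f : H -> H) (M : R) :
  (forall a x y, f (a *: x + y) = a *: f x + f y) ->
  (forall x, rnorm (f x) <= M * rnorm x) ->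
  exists T : bop H, forall x, T x = f x.
Proof.
move=> fl fM; have fB : f \in @bounded_operator R k H.
  apply/asboolP; split; first exact: fl.
  by exists M%:S => x; rewrite !norm_rnorm -rmorphM sofreal_le.
by exists (Bop fB).
Qed.

Lemma bopP (T : bop H) : linear T.
Proof. by case: T => f /= /asboolP[]. Qed.

Lemma bop0 (T : bop H) : T 0 = 0.
Proof. by have := bopP T (-1) 0 0; rewrite scaler0 addr0 scaleN1r addrC subrr. Qed.

Lemma bopD (T : bop H) x y : T (x + y) = T x + T y.
Proof. by rewrite -[x]scale1r bopP !scale1r. Qed.

Lemma bopZ (T : bop H) a x : T (a *: x) = a *: T x.
Proof. by rewrite -[a *: x]addr0 bopP bop0 addr0. Qed.

(** Apply Riesz to each B x. The resulting operator is linear over the full scalar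
    field thanks to the fourth hypothesis, which moves a scalar from one argument of B to the
    other as its conjugate. *)
Lemma bounded_form_operator (B : H -> H -> R) :
  (forall x x' y, B (x + x') y = B x y + B x' y) ->
  (forall x y y', B x (y + y') = B x y + B x y') ->
  (forall r x y, B x (r%:S *: y) = r * B x y) ->
  (forall a x y, B (a *: x) y = B x (sconj R k a *: y)) ->
  (forall x y, `|B x y| <= rnorm x * rnorm y) ->
  exists T : bop H, forall x y, rip (T x) y = B x y.
Proof.
move=> BDl BDr BZ Ba BM.
have /choice[f fE] x : exists z, forall y, B x y = rip y z.
  have [|||z zE] := @riesz (B x) (rnorm x); try by move=> *.
  by exists z.
have fE' x y : rip (f x) y = B x y by rewrite ripC -fE.
have [|x|T TE] := @bop_exists f 1; last by exists T => x y; rewrite TE.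
- by move=> a x y; apply: rip_ext => v; rewrite ripDl ripZC !fE' BDl Ba.
rewrite mul1r; have [->|fx] := eqVneq (rnorm (f x)) 0; first exact: rnorm_ge0.
have fx0 : 0 < rnorm (f x) by rewrite lt_neqAle eq_sym fx rnorm_ge0.
rewrite -(ler_pM2r fx0) -expr2 -rip_rnorm fE'; apply: le_trans (ler_norm _) _.
exact: BM.
Qed.

Lemma closed_subspaceP (V : set H) : closed_subspace V ->
  real_subspace V /\ forall a x, V x -> V (a *: x).
Proof.
move=> [Vc []]; rewrite inE => V0 VL.
have VZ a x : V x -> V (a *: x).
  move=> Vx; have := VL a x 0; rewrite !inE addr0; exact.
split=> //; split=> // [x y Vx Vy|r x]; last exact: VZ.
by have := VL 1 x y; rewrite !inE scale1r; exact.
Qed.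

Lemma orthogonal_projector_exists V : closed_subspace V ->
  exists P : bop H, orthogonal_projector V P.
Proof.
move=> /closed_subspaceP[VS VZ]; have [_ V0 VD VrZ] := VS.
have /choice[f fP] x : exists p, V p /\ forall v, V v -> rip (x - p) v = 0.
  by have [p Vp pO] := real_projection x VS; exists p.
have f_uniq x p : V p -> (forall v, V v -> rip (x - p) v = 0) -> f x = p.
  move=> Vp pO; have [Vf fO] := fP x.
  have VN : V (f x - p).
    by apply: VD => //; rewrite -scaleN1r; apply: VZ.
  apply/eqP; rewrite -subr_eq0; apply/eqP/rip_eq0.
  have := fO _ VN; have := pO _ VN; rewrite !ripE => h1 h2.
  by move: h1 h2; rewrite (ripC (f x) p); lra.
have [|x|P PE] := @bop_exists f 1.
- move=> a x y; apply: f_uniq.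
    by apply: VD; [apply: VZ|]; exact: (fP _).1.
  move=> v Vv; rewrite opprD addrACA -scalerBr ripDl ripZC.
  by rewrite (fP x).2 ?(fP y).2 ?addr0//; apply: VZ.
- rewrite mul1r -ler_sqr ?nnegrE ?rnorm_ge0// -!rip_rnorm.
  have := (fP x).2 _ (fP x).1; have := rip_ge0 (x - f x).
  by rewrite !ripE (ripC (f x) x) => *; lra.
- exists P => x; rewrite PE; split=> [|v Vv]; first exact: (fP x).1.
  apply: sre_ext => a; rewrite mulr0 sre0 -innerZl -/(rip _ _) ripZC.
  by apply: (fP x).2; apply: VZ.
Qed.
End Projections.

(** * Weak operator topology *)

Lemma initial_cvg (S : choiceType) (T : topologicalType) (f : S -> T)
    (F : set_system (initial_topology f)) (s : initial_topology f) :
  Filter F -> f @ F --> f s -> F --> s.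
Proof.
move=> FF fF A [_ [[B Bo <-] Bs BA]]; apply: filterS BA _.
by apply: fF; apply: open_nbhs_nbhs.
Qed.

Section WeakOperatorTopology.
Variables (R : realType) (k : scalar_kind) (H : hilbertType R k).
Local Notation "r %:S" := (sofreal R k r) (at level 2, format "r %:S").

Lemma scalar_cvg (X : Type) (F : set_system X) (f : X -> scalars R k)
    (z : scalars R k) : Filter F ->
  (forall a, (fun x => sre (a * f x)) @ F --> sre (a * z)) -> f @ F --> z.
Proof.
move=> FF fz; apply/cvgrPdist_lt => e /(@ball_sofreal _ _)[r r0 ->].
have [u le_u] := norm_le_sre R k.
have r2 : 0 < r / 2 by rewrite divr_gt0.
have /cvgrPdist_lt/(_ _ r2) h1 := fz 1.
have /cvgrPdist_lt/(_ _ r2) hu := fz u.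
apply: filterS2 h1 hu => x; rewrite !mul1r -!sreN -!sreD -mulrBr => h1 hu.
rewrite -norm_sofreal sofreal_lt; apply: le_lt_trans (le_u _) _.
by rewrite [r]splitr; exact: ltrD.
Qed.

(** Real parts of matrix coefficients suffice, as the other parts of <Sx, y> are real
    parts of <S(ax), y>. *)
Lemma wot_cvg (F : set_system (bop H)) (T : bop H) : Filter F ->
  (forall x y, (fun S : bop H => rip (S x) y) @ F --> rip (T x) y) -> F --> T.
Proof.
move=> FF FT; apply: (@initial_cvg _ _ (@matrix_coefs R k H)).
apply/cvg_sup => -[x y]; apply: initial_cvg => /=.
apply: (@scalar_cvg (bop H) F (fun S : bop H => inner (S x) y)) => a.
under eq_fun => S do rewrite -innerZl -bopZ.
by rewrite -innerZl -bopZ; exact: FT.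
Qed.

Lemma wot_continuous x y : continuous (fun T : bop H => rip (T x) y).
Proof.
move=> T.
have c1 : {for T, continuous (@matrix_coefs R k H)} by exact: initial_continuous.
have c2 := continuous_comp c1 (@proj_continuous _ _ (x, y) _).
exact: (continuous_comp c2 (@sre_continuous _ _ _)).
Qed.

End WeakOperatorTopology.

(** * Weakly continuous functionals *)

(** Induction on the family: if psi i does not vanish on the common kernel of the others,
    subtracting a multiple of psi i from phi makes phi vanish on that kernel. *)
Lemma functional_combination (R : realType) (V : lmodType R) (I : eqType)
    (psi : I -> V -> R) (phi : V -> R) (s : seq I) :
  (forall i a u v, psi i (a *: u + v) = a * psi i u + psi i v) ->
  (forall a u v, phi (a *: u + v) = a * phi u + phi v) ->
  (forall u, (forall i, i \in s -> psi i u = 0) -> phi u = 0) ->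
  exists c : seq (R * I), forall u, phi u = \sum_(p <- c) p.1 * psi p.2 u.
Proof.
move=> psiL; elim: s phi => [|i s IH] phi phiL phi0.
  by exists [::] => u; rewrite big_nil phi0.
have [ker_i|] := pselect (forall u, (forall j, j \in s -> psi j u = 0) -> psi i u = 0).
  apply: IH => // u su; apply: phi0 => j; rewrite inE => /predU1P[->|/su//].
  exact: ker_i.
move=> /existsNP[u /not_implyP[su /eqP iu]].
have [|v sv|c cE] := IH (fun v => phi v - phi u / psi i u * psi i v).
- by move=> a v w; rewrite phiL psiL; ring.
- have : phi (- (psi i v / psi i u) *: u + v) = 0.
    apply: phi0 => j; rewrite psiL inE => /predU1P[->|js].
      by field.
    by rewrite (su j js) (sv j js) mulr0 addr0.
  by rewrite phiL => <-; field.
- exists ((phi u / psi i u, i) :: c) => v.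
  by rewrite big_cons -cE /=; ring.
Qed.

Section WotFunctionals.
Variables (R : realType) (k : scalar_kind) (H : hilbertType R k).
Local Notation "r %:S" := (sofreal R k r) (at level 2, format "r %:S").

Lemma rip_bop_linear x y (r : R) (S T : bop H) :
  rip ((r *: S + T) x) y = r * rip (S x) y + rip (T x) y.
Proof. by rewrite -ripZl -ripDl. Qed.

(** Continuity at 0 bounds phi on a neighbourhood of 0 given by finitely many
    coefficients; the space where these vanish lies in it, and a linear functional
    bounded on a linear space vanishes there. *)
Lemma wot_functional_kernel (phi : {linear bop H -> R^o}) : continuous phi ->
  exists s : seq (H * H), forall T : bop H,
    (forall p, p \in s -> rip (T p.1) p.2 = 0) -> phi T = 0.
Proof.
move=> phiC.
pose A (se : seq (H * H) * R) :=
  [set T : bop H | forall p, p \in se.1 -> `|rip (T p.1) p.2| < se.2].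
pose G := filter_from [set se | 0 < se.2] A.
have GF : Filter G.
  apply: filter_from_filter; first by exists ([::], 1); rewrite /= ltr01.
  move=> [s e] [s' e'] /= e0 e'0.
  exists (s ++ s', Num.min e e'); first by rewrite /= lt_min e0.
  move=> T /= TA; split=> p /= ps; (have := TA p; rewrite mem_cat ps ?orbT => /(_ isT));
    by rewrite lt_min => /andP[].
have G0 : G --> (0 : bop H).
  apply: wot_cvg => x y; apply/cvgrPdist_lt => e e0.
  exists ([:: (x, y)], e) => //= T /(_ (x, y)); rewrite inE eqxx => /(_ isT) /=.
  by rewrite rip0l sub0r normrN.
have /cvgrPdist_lt/(_ 1 ltr01) : phi @ G --> phi 0.
  by move=> B /phiC /G0.
move=> [[s e] /= e0 sA]; exists s => T sT; apply/eqP/negPn/negP => pT.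
have /sA : A (s, e) ((phi T)^-1 *: T).
  move=> p /= /sT Tp; have := rip_bop_linear p.1 p.2 (phi T)^-1 T 0.
  by rewrite addr0 Tp mulr0 add0r rip0l => ->; rewrite normr0.
by rewrite /= linear0 linearZ /= sub0r normrN [_ *: _]mulVf// normr1 ltxx.
Qed.

Lemma wot_functional (phi : {linear bop H -> R^o}) : continuous phi ->
  exists c : seq (R * (H * H)), forall T : bop H,
    phi T = \sum_(p <- c) p.1 * rip (T p.2.1) p.2.2.
Proof.
move=> /wot_functional_kernel[s sP].
apply: (@functional_combination R (bop H) _
  (fun p (T : bop H) => rip (T p.1) p.2) phi s) => //.
- by move=> p a u v; exact: rip_bop_linear.
- by move=> a u v; rewrite linearP.
Qed.

Definition qform (T : bop H) (x : H) : R := rip (T x) x.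

Lemma rip_self_adjoint (T : bop H) x y : self_adjoint T -> rip (T x) y = rip (T y) x.
Proof. by move=> Ts; rewrite /rip Ts -/(rip _ _) ripC. Qed.

Lemma qform_comb (T : bop H) (a b : R) x y : self_adjoint T ->
  qform T (a%:S *: x + b%:S *: y) =
  a ^+ 2 * qform T x + 2 * (a * b * rip (T x) y) + b ^+ 2 * qform T y.
Proof.
move=> Ts; rewrite /qform bopD !bopZ !ripE (rip_self_adjoint y x)//; ring.
Qed.

(** On self-adjoint operators each coefficient is a difference of two quadratic forms, by
    polarization. *)
Lemma wot_functional_self_adjoint (phi : {linear bop H -> R^o}) : continuous phi ->
  exists c : seq (R * H), forall T : bop H, self_adjoint T ->
    phi T = \sum_(p <- c) p.1 * qform T p.2.
Proof.
move=> /wot_functional[c cP].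
suff [d dP] : exists d : seq (R * H), forall T : bop H, self_adjoint T ->
    \sum_(p <- c) p.1 * rip (T p.2.1) p.2.2 = \sum_(p <- d) p.1 * qform T p.2.
  by exists d => T Ts; rewrite cP dP.
elim: c {phi cP} => [|[r [x y]] c [d dP]]; first by exists [::] => T _; rewrite !big_nil.
exists [:: (r / 4, 1%:S *: x + 1%:S *: y), (- (r / 4), 1%:S *: x + (-1)%:S *: y) & d] => T Ts.
rewrite !big_cons /= dP// !qform_comb//; lra.
Qed.

End WotFunctionals.

(** * Positive functionals as sums of squares *)

Section SumsOfSquares.
Variables (R : realType) (k : scalar_kind) (H : hilbertType R k).
Implicit Types (x y e f g : H) (L : seq H) (T : bop H).
Local Notation "r %:S" := (sofreal R k r) (at level 2, format "r %:S").

Lemma rank1_exists x : exists T : bop H, forall y, T y = inner y x *: x.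
Proof.
apply: (@bop_exists _ _ _ (fun y => inner y x *: x) (rnorm x ^+ 2)).
  by move=> a y v; rewrite innerDl innerZl scalerDl scalerA.
move=> y; have [->|nz] := eqVneq (rnorm (inner y x *: x)) 0.
  by rewrite mulr_ge0 ?exprn_ge0 ?rnorm_ge0.
have lt0 : 0 < rnorm (inner y x *: x) by rewrite lt_neqAle eq_sym nz rnorm_ge0.
rewrite -(ler_pM2r lt0) -expr2 -(rip_rnorm (inner y x *: x)).
have -> : rip (inner y x *: x) (inner y x *: x) =
    rip x x * rip y (inner y x *: x).
  rewrite /rip innerZl [in LHS]innerZr -sreZ -/(rip x x) -inner_rip; congr sre.
  by rewrite innerZr mulrA [RHS]mulrC [sconj R k _ * _]mulrC.
rewrite rip_rnorm -[leRHS]mulrA ler_wpM2l ?exprn_ge0 ?rnorm_ge0//.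
by apply: le_trans (cauchy_schwarz _ _); exact: ler_norm.
Qed.

(** The tensor of x with its adjoint. These operators suffice to test the positivity of
    a combination of squares. *)
Definition rank1 x : bop H := projT1 (cid (rank1_exists x)).

Lemma rank1E x y : rank1 x y = inner y x *: x.
Proof. exact: (projT2 (cid (rank1_exists x))). Qed.

Lemma rip_rank1 x y v : rip (rank1 x y) v = sre (inner y x * inner x v).
Proof. by rewrite rank1E /rip innerZl. Qed.

Lemma qform_rank1 x y : qform (rank1 x) y = sre `|inner y x| ^+ 2.
Proof.
rewrite /qform rip_rank1 (innerC x y) mul_sconj.
by rewrite -norm_sofreal -rmorphXn !sre_sofreal.
Qed.

Lemma rank1_self_adjoint x : self_adjoint (rank1 x).
Proof.
by move=> y v; rewrite !rank1E innerZl innerZr -(innerC x v) mulrC.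
Qed.

Lemma qform_rank1_ge0 x y : 0 <= qform (rank1 x) y.
Proof. by rewrite qform_rank1 exprn_ge0// sre_ge0. Qed.

Lemma qform0 T : qform T 0 = 0.
Proof. by rewrite /qform bop0 rip0l. Qed.

Lemma qform_phase T (u : scalars R k) x : u * sconj R k u = 1 ->
  qform T (u *: x) = qform T x.
Proof.
by move=> uu; rewrite /qform /rip bopZ innerZl innerZr mulrA uu mul1r.
Qed.

Lemma qform_rank1_shift e x (t : scalars R k) y : inner y e = 0 ->
  qform (rank1 (x + t *: e)) y = qform (rank1 x) y.
Proof. by move=> ye; rewrite !qform_rank1 innerDr innerZr ye mulr0 addr0. Qed.

Lemma affine_ge0_slope (a b : R) : (forall t, 0 <= a + t * b) -> b = 0.
Proof.
move=> ab; apply/eqP/negPn/negP => b0.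
by have := ab ((- a - 1) / b); rewrite divfK// addrA subrr sub0r oppr_ge0 ler10.
Qed.

Definition qsum L T : R := \sum_(f <- L) qform T f.

Lemma qsum_nil T : qsum [::] T = 0.
Proof. exact: big_nil. Qed.

Lemma qsum_cons f L T : qsum (f :: L) T = qform T f + qsum L T.
Proof. exact: big_cons. Qed.

(** A form of linear independence suited to induction on the list: each vector has a
    witness e that sees it but none of its successors. *)
Fixpoint triangular L : Prop :=
  if L is f :: L' then
    (exists2 e, inner f e = 1 & forall h, h \in L' -> inner h e = 0) /\
    triangular L'
  else True.

Lemma triangular_uniq L : triangular L -> uniq L.
Proof.
elim: L => //= f L IH [[e fe Le] /IH ->]; rewrite andbT; apply/negP => /Le.
by rewrite fe => /eqP; rewrite oner_eq0.
Qed.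

Lemma qsum_rank1_shift L e x (t : scalars R k) :
  (forall h, h \in L -> inner h e = 0) ->
  qsum L (rank1 (x + t *: e)) = qsum L (rank1 x).
Proof. by move=> Le; apply: eq_big_seq => h /Le; exact: qform_rank1_shift. Qed.

(** A rotation (hyperbolic when w < 0) of the pair formed by f and c f + g gathers all the
    terms of f in a single square. *)
Lemma sum_square_rotation T (w c : R) f g : self_adjoint T -> 0 < 1 + w * c ^+ 2 ->
  let s := Num.sqrt (1 + w * c ^+ 2) in
  qform T (s%:S *: f + (w * c / s)%:S *: g) + w / s ^+ 2 * qform T g =
  qform T f + w * qform T (c%:S *: f + 1%:S *: g).
Proof.
move=> Ts s2 s; have s0 : s != 0 by rewrite gt_eqF// sqrtr_gt0.
rewrite !qform_comb//; have -> : s ^+ 2 = 1 + w * c ^+ 2 by rewrite sqr_sqrtr// ltW.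
rewrite [s * (_ / s)]mulrC divfK// exprMn exprVn.
rewrite sqr_sqrtr ?(ltW s2)//.
by field; rewrite gt_eqF.
Qed.

(** A weighted square, possibly negative, can be absorbed in a sum of squares as long as
    the total stays nonnegative. Let e be the witness of the head f; up to a phase,
    g = c f + g' with g' orthogonal to e and c real. Testing on e gives 1 + w c^2 >= 0.
    If this is positive, a rotation turns f into f1 and leaves a multiple of the square of
    g' to be absorbed by the tail: the total is still nonnegative, because any test vector
    can be made orthogonal to f1 by adding a multiple of e, which the tail and g' do not
    see. If it is zero, testing on g' + t e for all real t forces g' = 0, and the squares
    of f and g cancel. The last conclusion keeps the new tail orthogonal to e. *)
Lemma absorb_square L (w : R) g : triangular L ->
  (forall x, 0 <= qsum L (rank1 x) + w * qform (rank1 x) g) ->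
  exists L', [/\ triangular L',
    forall T, self_adjoint T -> qsum L' T = qsum L T + w * qform T g &
    forall e, (forall f, f \in L -> inner f e = 0) -> inner g e = 0 ->
      forall f, f \in L' -> inner f e = 0].
Proof.
elim: L w g => [|f L IH] w g.
  move=> _ pos; have [w0|w0] := leP w 0.
    exists [::]; split=> // T Ts; rewrite !qsum_nil add0r.
    have [->|] := eqVneq w 0; first by rewrite mul0r.
    move=> wn0; have {}w0 : w < 0 by rewrite lt_neqAle wn0.
    have := pos g; rewrite qsum_nil add0r nmulr_rge0// qform_rank1 inner_rip.
    rewrite sofreal_norm sre_sofreal real_normK ?num_real//.
    rewrite exprn_even_le0//= => /eqP/rip_eq0 ->.
    by rewrite qform0 mulr0.
  have [->|g0] := eqVneq g 0.
    by exists [::]; split=> // T Ts; rewrite !qsum_nil add0r qform0 mulr0.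
  exists [:: (Num.sqrt w)%:S *: g]; split=> [|T Ts|e _ ge h].
  - split=> //; exists ((Num.sqrt w * rip g g)^-1%:S *: g) => //.
    rewrite innerZl innerZr sconj_sofreal inner_rip -!rmorphM.
    suff -> : Num.sqrt w * ((Num.sqrt w * rip g g)^-1 * rip g g) = 1.
      by rewrite rmorph1.
    have gg0 : rip g g != 0 by apply: contra_neq g0; exact: rip_eq0.
    by field; rewrite gg0 gt_eqF// sqrtr_gt0.
  - rewrite qsum_cons !qsum_nil addr0 add0r /qform bopZ ripZl ripZr mulrA -expr2.
    by rewrite sqr_sqrtr// ltW.
  - by rewrite inE => /eqP ->; rewrite innerZl ge mulr0.
move=> [[e fe Le] Ltri] pos.
have [u uu] := phase (inner g e); rewrite -norm_sofreal.
set c := sre _ => uge.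
pose g' := u *: g - c%:S *: f.
have ugE : u *: g = c%:S *: f + 1%:S *: g'.
  by rewrite rmorph1 scale1r /g' addrC subrK.
have g'e : inner g' e = 0.
  by rewrite /g' innerDl innerZl uge -scaleNr innerZl fe mulr1 subrr.
have orth_g' h : inner f h = 0 -> inner g h = 0 -> inner g' h = 0.
  by move=> fh gh; rewrite /g' innerDl innerZl -scaleNr innerZl fh gh !mulr0 addr0.
clearbody g'.
have qg T : qform T g = qform T (c%:S *: f + 1%:S *: g').
  by rewrite -ugE qform_phase.
have s2_ge0 : 0 <= 1 + w * c ^+ 2.
  have := pos e; rewrite qsum_cons /qsum big1_seq => [|h /andP[_ /Le he]].
    rewrite addr0 qg !qform_rank1 fe innerDl !innerZl fe g'e mulr1 mulr0 addr0.
    rewrite normr1 sofreal_norm !sre_sofreal real_normK ?num_real//.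
    by rewrite -(rmorph1 (sofreal R k)) sre_sofreal expr1n.
  by rewrite qform_rank1 he normr0 sre0 expr0n.
have [s20|s2n0] := eqVneq (1 + w * c ^+ 2) 0.
  have wc0 : w * c != 0.
    apply/eqP => wc; move: s20; rewrite expr2 mulrA wc mul0r addr0 => /eqP.
    by rewrite oner_eq0.
  (* At g' + t e the total is affine in t, with slope 2 w c |g'|^2. *)
  have g'0 : g' = 0.
    apply: rip_eq0.
    suff /eqP : 2 * (w * c * rip g' g') = 0.
      by rewrite !mulf_eq0 pnatr_eq0/= -mulf_eq0 (negPf wc0) => /eqP.
    apply: (@affine_ge0_slope (qsum L (rank1 g') +
      2 * (w * c * rip g' g' * rip f g') + w * rip g' g' ^+ 2)) => t.
    have := pos (g' + t%:S *: e); rewrite qsum_cons.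
    rewrite (qsum_rank1_shift _ _ Le) qg qform_comb; last exact: rank1_self_adjoint.
    have -> : rip (rank1 (g' + t%:S *: e) f) g' = rip g' g' * (rip f g' + t).
      rewrite rip_rank1 (innerC _ g') !innerDr !innerZr g'e fe mulr0 addr0 mulr1.
      rewrite inner_rip !sconj_sofreal mulrC sreZ sreD sre_sofreal.
      by rewrite -/(rip f g').
    rewrite (qform_rank1_shift _ _ g'e) [qform (rank1 g') g']qform_rank1.
    rewrite inner_rip sofreal_norm sre_sofreal real_normK ?num_real//.
    move: (qform (rank1 _) f) => a; rewrite -[leRHS]subr0.
    have e0 : a * (1 + w * c ^+ 2) = 0 by rewrite s20 mulr0.
    by rewrite -[X in _ - X]e0; congr (_ <= _); ring.
  exists L; split=> // [T Ts|h hL _ h' h'L]; last by apply: hL; rewrite inE h'L orbT.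
  rewrite qsum_cons qg g'0 qform_comb// qform0 rip0r -[LHS]addr0.
  have e0 : qform T f * (1 + w * c ^+ 2) = 0 by rewrite s20 mulr0.
  by rewrite -[X in _ + X = _]e0; ring.
have s2 : 0 < 1 + w * c ^+ 2 by rewrite lt_neqAle eq_sym s2n0.
set s := Num.sqrt (1 + w * c ^+ 2).
have s0 : s != 0 by rewrite gt_eqF// sqrtr_gt0.
pose f1 := s%:S *: f + (w * c / s)%:S *: g'.
have rot T : self_adjoint T ->
    qform T f1 + w / s ^+ 2 * qform T g' = qform T f + w * qform T g.
  by move=> Ts; rewrite qg; exact: sum_square_rotation.
have f1e : inner f1 e = s%:S.
  by rewrite innerDl !innerZl fe g'e mulr1 mulr0 addr0.
have [|L' [L'tri L'q L'o]] := IH (w / s ^+ 2) g' Ltri.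
  (* x + t e is orthogonal to f1. *)
  move=> x; pose t := - (s^-1%:S * sconj R k (inner f1 x)).
  have := pos (x + t *: e); rewrite qsum_cons addrAC.
  rewrite -rot; last exact: rank1_self_adjoint.
  rewrite (qsum_rank1_shift _ _ Le) (qform_rank1_shift _ _ g'e) qform_rank1.
  rewrite innerDr innerZr f1e /t rmorphN rmorphM sconjK sconj_sofreal.
  rewrite mulNr mulrAC -rmorphM mulVf// rmorph1 mul1r subrr normr0 sre0 expr0n.
  by rewrite add0r addrC.
exists (f1 :: L'); split.
- split=> //; exists (s^-1%:S *: e).
    by rewrite innerZr f1e sconj_sofreal -rmorphM mulVf// rmorph1.
  by move=> h hL'; rewrite innerZr (L'o e)// mulr0.
- move=> T Ts; rewrite !qsum_cons L'q// addrCA rot//.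
  by rewrite addrCA addrA.
- move=> e' fLe' ge'; have fe' : inner f e' = 0 by rewrite fLe'// mem_head.
  have g'e' := orth_g' _ fe' ge'.
  move=> h; rewrite inE => /predU1P[->|].
    by rewrite innerDl !innerZl fe' g'e' !mulr0 addr0.
  by apply: L'o => // h' h'L; rewrite fLe'// inE h'L orbT.
Qed.

End SumsOfSquares.

Section PositiveFunctionals.
Variables (R : realType) (k : scalar_kind) (H : hilbertType R k).
Implicit Types (x y e f g : H) (L : seq H) (T N : bop H).
Local Notation "r %:S" := (sofreal R k r) (at level 2, format "r %:S").

(** The minimum in the hypothesis keeps every partial total nonnegative, whatever the order
    of the weights in c. *)
Lemma absorb_squares (c : seq (R * H)) L : triangular L ->
  (forall x, 0 <= qsum L (rank1 x) +
    \sum_(p <- c) Num.min p.1 0 * qform (rank1 x) p.2) ->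
  exists2 L', triangular L' & forall T, self_adjoint T ->
    qsum L' T = qsum L T + \sum_(p <- c) p.1 * qform T p.2.
Proof.
elim: c L => [|[w g] c IH] L Ltri pos.
  by exists L => // T _; rewrite big_nil addr0.
have min_le x : Num.min w 0 * qform (rank1 x) g <= w * qform (rank1 x) g.
  by rewrite ler_wpM2r ?qform_rank1_ge0// ge_min lexx.
have [x|L1 [L1tri L1q _]] := @absorb_square _ _ _ L w g Ltri.
  have := pos x; rewrite big_cons /= => h.
  have : \sum_(p <- c) Num.min p.1 0 * qform (rank1 x) p.2 <= 0.
    apply: sumr_le0 => p _; rewrite mulr_le0_ge0 ?qform_rank1_ge0//.
    by rewrite ge_min lexx orbT.
  by have := min_le x; lra.
have [x|L' L'tri L'q] := IH L1 L1tri.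
  rewrite L1q; last exact: rank1_self_adjoint.
  by have := pos x; have := min_le x; rewrite big_cons /=; lra.
exists L' => // T Ts.
by rewrite L'q// L1q// big_cons /= addrA.
Qed.

(** The squares of positive weight are absorbed before those of negative weight, so that
    each partial total of the second stage is at least the value of phi, hence
    nonnegative. *)
Lemma positive_functional (phi : {linear bop H -> R^o}) :
  continuous phi -> (forall N, nonneg_operators N -> 0 <= phi N) ->
  exists2 L, uniq L & forall T, self_adjoint T -> phi T = qsum L T.
Proof.
move=> /wot_functional_self_adjoint[c cP] phi_ge0.
have [x|L1 L1tri L1q] := @absorb_squares [seq p <- c | 0 <= p.1] [::] I.
  rewrite qsum_nil add0r big_filter big1// => p p0.
  by rewrite min_r// mul0r.
have [x|L Ltri Lq] := @absorb_squares [seq p <- c | ~~ (0 <= p.1)] L1 L1tri.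
  have xs := rank1_self_adjoint x.
  rewrite L1q// qsum_nil add0r !big_filter.
  rewrite [X in 0 <= X](_ : _ = phi (rank1 x)); last first.
    rewrite cP// [RHS](bigID (fun p : R * H => 0 <= p.1)) /=; congr (_ + _).
    by apply: eq_bigr => p; rewrite -ltNge => /ltW p0; rewrite min_l.
  apply: phi_ge0; split=> // y.
  rewrite rank1E innerZl (innerC x y) mul_sconj.
  by rewrite exprn_ge0.
exists L => [|T Ts]; first exact: triangular_uniq.
by rewrite Lq// L1q// qsum_nil add0r !big_filter cP// [LHS](bigID (fun p : R * H => 0 <= p.1)).
Qed.

Lemma qsum_linear L (a : R) T T' : qsum L (a *: T + T') = a * qsum L T + qsum L T'.
Proof.
rewrite /qsum big_distrr -big_split /=; apply: eq_bigr => f _.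
exact: rip_bop_linear.
Qed.

(** The codomain R^o is the one half-spaces are defined with. *)
Definition qfun L : bop H -> R^o := qsum L.

HB.instance Definition _ L :=
  GRing.isLinear.Build R (bop H) R^o _ (qfun L) (qsum_linear L).

Lemma qfun_continuous L : continuous (qfun L).
Proof.
elim: L => [|f L IH] T.
  have -> : qfun [::] = fun=> 0 by apply/funext => S; exact: qsum_nil.
  exact: cst_continuous.
have -> : qfun (f :: L) = (fun S : bop H => (rip (S f) f : R^o) + qfun L S).
  by apply/funext => S; exact: qsum_cons.
by apply: cvgD; [exact: nbhs_filter|exact: wot_continuous|exact: IH].
Qed.

Lemma qsum_nonneg L N : nonneg_operators N -> 0 <= qsum L N.
Proof. by move=> [_ N0]; apply: sumr_ge0 => f _; apply: sre_ge0. Qed.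

Lemma nonnegZ (t : R) N : 0 <= t -> nonneg_operators N -> nonneg_operators (t *: N).
Proof.
move=> t0 [Ns N0]; split=> [x y|x].
  rewrite [LHS](innerZl t%:S (N x)) Ns.
  by rewrite [RHS](innerZr t%:S x (N y)) sconj_sofreal.
rewrite [leRHS](innerZl t%:S (N x)) mulr_ge0//.
by rewrite -(rmorph0 (sofreal R k)) sofreal_le.
Qed.

Lemma nonneg0 : nonneg_operators (0 : bop H).
Proof.
have i0 x : inner (0 : H) x = 0 by rewrite -(scale0r 0) innerZl mul0r.
split=> [x y|x]; last by rewrite [leRHS]i0.
by rewrite [LHS]i0 [RHS]innerC [inner _ x]i0 rmorph0.
Qed.

Lemma half_space_closed (phi : {linear bop H -> R^o}) a : continuous phi ->
  closed (half_space phi a).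
Proof.
move=> phiC; apply: (@closed_comp _ _ phi [set r | a <= r]) => [T _|].
  exact: phiC.
exact: closed_ge.
Qed.

(** The boundary of a half-space does not depend on its equation. If phi T > a, then
    2 T0 - T is outside the first half-space; but psi T is the least value of psi on the
    second one, which contains T0, so 2 T0 - T belongs to it. *)
Lemma half_space_contact (phi psi : {linear bop H -> R^o}) a b T0 T :
  half_space phi a = half_space psi b -> phi T0 = a -> psi T = b -> phi T = a.
Proof.
move=> eqS pT0 pT.
have inS S : (a <= phi S) = (b <= psi S) :> Prop.
  by have := congr1 (fun A => A S) eqS.
have aT : a <= phi T by rewrite inS pT.
apply/eqP; rewrite eq_le aT andbT leNgt; apply/negP => lt_aT.
have bT0 : b <= psi T0 by rewrite -inS pT0.
have : b <= psi (2 *: T0 - T).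
  by rewrite linearB linearZ /= pT; move: bT0; rewrite /GRing.scale /=; lra.
by rewrite -inS linearB linearZ /= pT0 /GRing.scale /=; lra.
Qed.

End PositiveFunctionals.

(** * Distances and projectors *)

Section Projectors.
Variables (R : realType) (k : scalar_kind) (H : hilbertType R k).
Implicit Types (V : set H) (P Q : bop H).
Local Notation "r %:S" := (sofreal R k r) (at level 2, format "r %:S").

Section OneProjector.
Variables (V : set H) (P Q : bop H).
Hypotheses (VC : closed_subspace V) (PP : orthogonal_projector V P).
Hypothesis QE : forall x, Q x = x - P x.

Lemma inner_coprojector x y : inner (Q x) y = inner (Q x) (Q y).
Proof.
rewrite -[in LHS](subrK (P y) y) -QE innerDr [Q x]QE.
by rewrite ((PP x).2 _ (PP y).1) addr0.
Qed.

Lemma coprojector_self_adjoint : self_adjoint Q.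
Proof. by move=> x y; rewrite inner_coprojector innerC -inner_coprojector -innerC. Qed.

Lemma qform_coprojector x : qform Q x = rnorm (Q x) ^+ 2.
Proof. by rewrite -rip_rnorm /qform /rip inner_coprojector. Qed.

Lemma coprojector_contraction x : rnorm (Q x) <= rnorm x.
Proof.
have [->|Qx] := eqVneq (rnorm (Q x)) 0; first exact: rnorm_ge0.
have Qx0 : 0 < rnorm (Q x) by rewrite lt_neqAle eq_sym Qx rnorm_ge0.
rewrite -(ler_pM2l Qx0) -expr2 -qform_coprojector.
by apply: le_trans (cauchy_schwarz _ _); exact: ler_norm.
Qed.

Lemma dist_coprojector x : dist x V ^+ 2 = qform Q x.
Proof.
rewrite qform_coprojector; congr (_ ^+ 2); rewrite QE.
have [[_ V0 VD _] VZ] := closed_subspaceP VC.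
have lb v : V v -> rnorm (x - P x) <= rnorm (x - v).
  move=> Vv; rewrite -ler_sqr ?nnegrE ?rnorm_ge0// -!rip_rnorm.
  have Vw : V (P x - v).
    by apply: VD; [exact: (PP x).1|rewrite -scaleN1r; exact: VZ].
  have -> : x - v = (x - P x) + (P x - v) by rewrite addrA subrK.
  have := rip_ge0 (P x - v); have : rip (x - P x) (P x - v) = 0.
    by rewrite /rip (PP x).2// sre0.
  move: (x - P x) (P x - v) => y w yw w0.
  by rewrite ripDl !ripDr (ripC w y) yw; lra.
apply/eqP; rewrite eq_le; apply/andP; split.
  apply: ge_inf; last by exists (P x) => //; exact: (PP x).1.
  by exists 0 => _ [v _ <-]; exact: rnorm_ge0.
apply: lb_le_inf; first by exists (rnorm (x - 0)), 0.
by move=> _ [v Vv <-]; exact: lb.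
Qed.

End OneProjector.

Lemma projectors_exists (C : set (set H)) V : C V -> closed_subspace V ->
  exists2 Q, projectors C Q &
    forall F, approx_error F V = qsum F Q.
Proof.
move=> CV Vc; have [P PP] := orthogonal_projector_exists Vc.
have [|x|Q QE] := @bop_exists _ _ _ (fun x => x - P x) 1.
- by move=> a x y; rewrite bopD bopZ opprD addrACA scalerBr.
- rewrite mul1r -ler_sqr ?nnegrE ?rnorm_ge0// -!rip_rnorm.
  have : rip (x - P x) (P x) = 0 by rewrite /rip ((PP x).2 _ (PP x).1) sre0.
  by have := rip_ge0 (P x); rewrite !ripE (ripC (P x) x); lra.
- exists Q; first by exists V, P.
  by move=> F; apply: eq_bigr => f _; exact: (dist_coprojector Vc PP QE).
Qed.

Lemma projectorsP (C : set (set H)) Q :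
  (forall V, C V -> closed_subspace V) -> projectors C Q ->
  [/\ self_adjoint Q, forall x, rnorm (Q x) <= rnorm x &
      exists2 V, C V & forall F, approx_error F V = qsum F Q].
Proof.
move=> CV [V [P [VC PP QE]]]; split.
- exact: (coprojector_self_adjoint PP QE).
- exact: (coprojector_contraction PP QE).
- exists V => // F; apply: eq_bigr => f _.
  exact: (dist_coprojector (CV _ VC) PP QE).
Qed.

Lemma projectors_Cplus (C : set (set H)) : projectors C `<=` Cplus C.
Proof. by move=> Q CQ; exists Q => //; exists 0; [exact: nonneg0|rewrite addr0]. Qed.

(** Weak compactness of the unit ball: along the ultrafilter each matrix coefficient stays
    in a compact interval, hence converges, and the limits form a bounded form, which
    comes from an operator by Riesz. *)
Lemma contraction_ultra_cvg (U : set_system (bop H)) : UltraFilter U ->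
  U [set T : bop H | forall x, rnorm (T x) <= rnorm x] ->
  exists Q : bop H, U --> Q.
Proof.
move=> UU UT.
have /choice[B BP] (xy : H * H) : exists r : R,
    `|r| <= rnorm xy.1 * rnorm xy.2 /\ (fun T : bop H => rip (T xy.1) xy.2) @ U --> r.
  case: xy => x y /=; set M := rnorm x * rnorm y.
  pose f (T : bop H) := rip (T x) y.
  have fU : (f @ U) [set` `[- M, M]].
    rewrite /fmap /=; apply: filterS UT => T Tx /=.
    rewrite in_itv /= -ler_norml; apply: le_trans (cauchy_schwarz _ _) _.
    by rewrite ler_wpM2r ?rnorm_ge0.
  have [r [rM rcl]] := @segment_compact R (- M) M (f @ U) _ fU.
  exists r; split; first by move: rM; rewrite /= in_itv /= ler_norml.
  move=> A rA; have [//|UnA] := in_ultra_setVsetC (f @^-1` A) UU.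
  by have [z [nAz Az]] := rcl (~` A) A UnA rA.
have uniq_lim (f : bop H -> R) (r s : R) : f @ U --> r -> f @ U --> s -> r = s.
  by apply: cvg_unique; exact: Rhausdorff.
have BU x y : (fun T : bop H => rip (T x) y) @ U --> B (x, y) := (BP (x, y)).2.
have [x x' y|x y y'|r x y|a x y|x y|Q QE] :=
    @bounded_form_operator _ _ H (fun x y => B (x, y)).
- apply: uniq_lim (BU _ _) _; under eq_fun do rewrite bopD ripDl.
  exact: cvgD.
- apply: uniq_lim (BU _ _) _; under eq_fun do rewrite ripDr.
  exact: cvgD.
- apply: uniq_lim (BU _ _) _; under eq_fun do rewrite ripZr.
  by apply: cvgM => //; exact: cvg_cst.
- apply: uniq_lim (BU _ _) _; under eq_fun do rewrite bopZ ripZC.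
  exact: BU.
- exact: (BP (x, y)).1.
- by exists Q; apply: wot_cvg => x y; rewrite QE; exact: BU.
Qed.

End Projectors.

(** * Contact half-spaces *)

Section ContactHalfSpaces.
Variables (R : realType) (k : scalar_kind) (H : hilbertType R k).
Variable C : set (set H).
Hypothesis CV : forall V, C V -> closed_subspace V.

Lemma Cplus_self_adjoint T : Cplus C T -> self_adjoint T.
Proof.
move=> [Q /(projectorsP CV)[Qs _ _] [N [Ns _] <-]] x y.
by rewrite [LHS]innerDl [RHS]innerDr Qs Ns.
Qed.

Lemma Cplus_ge L a : (forall Q, projectors C Q -> a <= qsum L Q) ->
  Cplus C `<=` half_space (qfun L) a.
Proof.
move=> aQ _ [Q CQ [N N0 <-]]; rewrite /half_space /= linearD.
by apply: le_trans (aQ _ CQ) _; rewrite lerDl; exact: qsum_nonneg.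
Qed.

Lemma closure_half_space (E : set (bop H)) (phi : {linear bop H -> R^o}) a :
  continuous phi -> E `<=` half_space phi a -> closure E `<=` half_space phi a.
Proof.
move=> phiC ES; have /closure_id -> := half_space_closed (a := a) phiC.
exact: closure_subset.
Qed.

Lemma contact_closure (E : set (bop H)) :
  contact_half_spaces E `<=` contact_half_spaces (closure E).
Proof.
move=> S [phi [a [phiC SE ES [T [ET Ta]]]]]; exists phi, a; split => //.
  by rewrite SE; apply: closure_half_space => //; rewrite -SE.
by exists T; split => //; exact: subset_closure.
Qed.

(** Cplus C is stable under adding nonnegative multiples of N, so phi cannot be negative at N. *)
Lemma half_space_positive (phi : {linear bop H -> R^o}) a N : C !=set0 ->
  Cplus C `<=` half_space phi a -> nonneg_operators N -> 0 <= phi N.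
Proof.
move=> [V VC] CS N0; have [Q CQ _] := projectors_exists VC (CV VC).
rewrite leNgt; apply/negP => pN.
(* This multiple of N brings phi below a. *)
pose t : R := (`|phi Q - a| + 1) / - phi N.
have t0 : 0 <= t by rewrite divr_ge0 ?oppr_ge0 ?addr_ge0// ltW.
have /CS : Cplus C (Q + t *: N).
  by exists Q => //; exists (t *: N) => //; exact: nonnegZ.
rewrite /half_space /= linearD linearZ /= -[t *: _]/(t * phi N).
have -> : t * phi N = - (`|phi Q - a| + 1).
  by rewrite /t invrN mulrN mulNr divfK// lt_eqF.
by have := ler_norm (phi Q - a : R); lra.
Qed.

(** On C the functional phi of a contact half-space is the approximation error of a finite
    set F, so a minimizer V of this error gives the least value of phi on Cplus C. This
    least value is also the one on the closure, namely a. *)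
Lemma MSAP_contact : C !=set0 -> MSAP C ->
  contact_half_spaces (closure (Cplus C)) `<=` contact_half_spaces (Cplus C).
Proof.
move=> C0 msap S [phi [a [phiC SE ES [T [ET Ta]]]]]; exists phi, a.
have CS : Cplus C `<=` half_space phi a.
  by rewrite -SE; apply: subset_trans ES; exact: subset_closure.
split=> //; first by rewrite SE.
have phi_ge0 N := half_space_positive (N := N) C0 CS.
have [L Lu Lq] := positive_functional phiC phi_ge0.
have [F FL] : exists F : {fset H}, forall Q, qsum F Q = qsum L Q.
  exists [fset x in L]%fset => Q; apply: perm_big.
  by apply: uniq_perm => [||x]; [exact: fset_uniq|exact: Lu|rewrite inE].
have [V VC Vmin] := msap F.
have [Q CQ Qerr] := projectors_exists VC (CV VC).
have QC := projectors_Cplus CQ.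
have Qmin : Cplus C `<=` half_space phi (phi Q).
  move=> T' CT'; rewrite /half_space /= !Lq; try exact: Cplus_self_adjoint.
  apply: Cplus_ge CT' => Q' CQ'; have [_ _ [W WC Werr]] := projectorsP CV CQ'.
  by rewrite -!FL -Qerr -Werr; exact: Vmin.
exists Q; split=> //; rewrite /hyperplane /=; apply/eqP; rewrite eq_le.
apply/andP; split; last exact: CS.
by rewrite -Ta; exact: (closure_half_space phiC Qmin ET).
Qed.

(** A weak limit Q of a minimizing ultrafilter of projectors lies in the closure of Cplus C
    and has error a, the infimum. Hence a half-space touches the closure at Q; by
    hypothesis it touches Cplus C at some Q' + N too, and Q' has error at most a. *)
Lemma contact_MSAP : C !=set0 ->
  contact_half_spaces (closure (Cplus C)) `<=` contact_half_spaces (Cplus C) ->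
  MSAP C.
Proof.
move=> [V0 V0C] sub F; pose a := inf [set approx_error F V | V in C].
have infE : has_inf [set approx_error F V | V in C].
  split; first by exists (approx_error F V0), V0.
  by exists 0 => _ [V _ <-]; apply: sumr_ge0 => f _; rewrite sqr_ge0.
have aQ Q : projectors C Q -> a <= qsum F Q.
  move=> /(projectorsP CV)[_ _ [V VC <-]].
  by apply: ge_inf; [case: infE|exists V].
pose G := filter_from [set e : R | 0 < e]
  (fun e => [set Q | projectors C Q /\ qsum F Q < a + e]).
have GF : ProperFilter G.
  apply: filter_from_proper; last first.
    move=> e /= e0; have [_ [V VC <-] Ve] := inf_adherent e0 infE.
    have [Q CQ Qerr] := projectors_exists VC (CV VC).
    by exists Q; split => //; rewrite -Qerr.
  apply: filter_from_filter; first by exists 1; rewrite /= ltr01.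
  move=> e e' /= e0 e'0; exists (Num.min e e'); first by rewrite /= lt_min e0.
  move=> Q [CQ]; rewrite -ltrBlDl lt_min !ltrBlDl => /andP[? ?].
  by split; split.
have [U [UU GU]] := ultraFilterLemma GF.
have UC : U (projectors C) by apply: GU; exists 1 => [|Q []//]; rewrite /= ltr01.
have [Q UQ] : exists Q : bop H, U --> Q.
  apply: contraction_ultra_cvg; apply: filterS UC => Q.
  by move=> /(projectorsP CV)[].
have clQ : closure (Cplus C) Q.
  move=> B /UQ UB; have [T [CT BT]] := filter_ex (filterI UC UB).
  by exists T; split=> //; exact: projectors_Cplus.
have CS := Cplus_ge aQ.
have clS := closure_half_space (@qfun_continuous _ _ _ F) CS.
have Qa : qfun F Q = a.
  apply/eqP; rewrite eq_le; apply/andP; split; last exact: clS.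
  apply/ler_addgt0Pr => e e0.
  have qQ : qfun F @ U --> qfun F Q by move=> B /qfun_continuous /UQ.
  apply: (@closed_cvg _ _ U _ (qfun F) [set r | r <= a + e]) qQ.
    exact: closed_le.
  by apply: GU; exists e => // T [_ /ltW].
have [|psi [b [_ SE _ [T [CT Tb]]]]] := sub (half_space (qfun F) a).
  exists (qfun F), a; split=> //; first exact: qfun_continuous.
  by exists Q.
have Ta := half_space_contact SE Qa Tb.
case: CT Ta => Q' CQ' [N N0 <-]; rewrite linearD => Ta.
have [_ _ [V VC Verr]] := projectorsP CV CQ'.
exists V => // W WC; rewrite Verr; apply: (@le_trans _ _ a).
  by rewrite -Ta lerDl; exact: qsum_nonneg.
by apply: ge_inf; [case: infE|exists W].
Qed.

End ContactHalfSpaces.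

Theorem theorem2p9 (R : realType) (k : scalar_kind) (H : hilbertType R k)
    (C : set (set H)) (sepH : separable H) (C0 : C !=set0)
    (CV : forall V : set H, C V -> closed_subspace V) :
  MSAP C <->
  contact_half_spaces (Cplus C) = contact_half_spaces (closure (Cplus C)).
Proof.
split=> [msap|TE]; last by apply: contact_MSAP => //; rewrite TE.
by apply/seteqP; split; [exact: contact_closure|exact: MSAP_contact].
Qed.
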